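(* There exist absolute constants $c_1,c_2>0$ such that the following holds. Let $\mathcal{S}$ be an $(L,\epsilon,T,M,r)$-smoother on $\mathbb{R}^d$ which satisfies $\mathsf{TICF}$. Then $$L\sqrt{\log\left((M+1)(T+1)\right)}\ \geq\ c_1\cdot\frac{\sqrt{d}}{r}\,(c_2-\epsilon).$$
   Context: $\|\cdot\|$ is the Euclidean norm on $\mathbb{R}^d$, $\|f-g\|_\infty=\sup_{\mathbf{x}}|f(\mathbf{x})-g(\mathbf{x})|$. Local oracle: an oracle $\mathbb{O}$ assigns to every function $f$ and point $\mathbf{x}$ a quantity $\mathbb{O}_f(\mathbf{x})$; it is local if for any $\mathbf{x}$ and any $f,g$ that are equal over some neighborhood of $\mathbf{x}$, $\mathbb{O}_f(\mathbf{x})=\mathbb{O}_g(\mathbf{x})$. Smoother: an algorithm $\mathcal{S}$ is an $(L,\epsilon,T,M,r)$-smoother ($L,\epsilon,M,r>0$, $T\in\mathbb{N}$, $T\ge 1$) if for any $1$-Lipschitz function $f$ on $\mathbb{R}^d$ there exists a differentiable function $\tilde f$ on $\mathbb{R}^d$ such that: (1) $\|f-\tilde f\|_\infty\leq\epsilon$, and $\nabla\tilde f$ is $L$-Lipschitz. (2) Given any $\mathbf{x}\in\mathbb{R}^d$, the algorithm produces a (possibly randomized) query sequence $\{\mathbf{x}_1,\dots,\mathbf{x}_T\}\subset\{\mathbf{y}:\|\mathbf{y}-\mathbf{x}\|\leq r\}$ of the form $\mathbf{x}_{i+1}=\mathcal{S}^{(i)}(\xi,\mathbf{x},\mathbb{O}_f(\mathbf{x}_1),\dots,\mathbb{O}_f(\mathbf{x}_i))$,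 where $\mathcal{S}^{(i)}$ maps all the previous information gathered by the queries of some local oracle $\mathbb{O}_f$ to a new query, possibly based on a draw of some random variable $\xi$ (arbitrary randomness; the first query depends only on $\xi,\mathbf{x}$). Finally it produces a vector $\mathcal{S}(f,\mathbf{x}):=\mathcal{S}^{(out)}(\xi,\mathbf{x},\mathbb{O}_f(\mathbf{x}_1),\dots,\mathbb{O}_f(\mathbf{x}_T))$, where $\mathcal{S}^{(out)}$ is some mapping to $\mathbb{R}^d$, such that $\|\mathbb{E}_\xi[\mathcal{S}(f,\mathbf{x})]-\nabla\tilde f(\mathbf{x})\|\leq\epsilon$ and $\Pr_\xi[\|\mathcal{S}(f,\mathbf{x})\|\leq M]=1$. $\mathsf{TICF}$ (translation invariance w.r.t. constant functions): $\mathcal{S}$ satisfies $\mathsf{TICF}$ if for any two constant functions $f,g$, any $\mathbf{x}\in\mathbb{R}^d$, any query index $i$ (including the first query, which uses no oracle responses), and any realization of $\xi$, $\mathcal{S}^{(i)}(\xi,\mathbf{x},\mathbb{O}_f(\mathbf{x}_1),\dots,\mathbb{O}_f(\mathbf{x}_i))=\mathcal{S}^{(i)}(\xi,\mathbf{0},\mathbb{O}_g(\mathbf{x}_1-\mathbf{x}),\dots,\mathbb{O}_g(\mathbf{x}_i-\mathbf{x}))+\mathbf{x}$, and $\mathcal{S}^{(out)}(\xi,\mathbf{x},\mathbb{O}_f(\mathbf{x}_1),\dots,\mathbb{O}_f(\mathbf{x}_T))=\mathcal{S}^{(out)}(\xi,\mathbf{0},\mathbb{O}_g(\mathbf{x}_1-\mathbf{x}),\dots,\mathbb{O}_g(\mathbf{x}_T-\mathbf{x}))$,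 where $\mathbf{x}_1,\dots,\mathbf{x}_T$ are the queries. That is, on constant functions the queries only shift with the input point and the output is unchanged. *)

(* Defs.v *)
From HB Require Import structures.
From mathcomp Require Import all_boot all_order all_algebra.
From mathcomp Require Import all_classical all_reals all_analysis.

Set Implicit Arguments.
Unset Strict Implicit.
Unset Printing Implicit Defensive.

Import Order.TTheory GRing.Theory Num.Theory.
Import numFieldNormedType.Exports.

Local Open Scope classical_set_scope.
Local Open Scope ring_scope.

(* The library norm `|x| on 'rV[R]_d is the sup norm. It is used below only for
   the topology and for differentiability, which are the same for both norms. *)
Definition enorm (R : realType) (d : nat) (x : 'rV[R]_d) : R :=
  Num.sqrt (\sum_(j < d) x 0 j ^+ 2).

Definition elipschitz (R : realType) (d : nat) (k : R) (f : 'rV[R]_d -> R) :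
    Prop :=
  forall x y, `|f x - f y| <= k * enorm (x - y).

Definition elipschitz_vec (R : realType) (d : nat) (k : R)
    (F : 'rV[R]_d -> 'rV[R]_d) : Prop :=
  forall x y, enorm (F x - F y) <= k * enorm (x - y).

Definition sup_dist (R : realType) (d : nat) (f g : 'rV[R]_d -> R) : \bar R :=
  ereal_sup [set `|f x - g x|%:E | x in [set: 'rV[R]_d]].

Definition gradient (R : realType) (d : nat) (f : 'rV[R]_d -> R)
    (x : 'rV[R]_d) : 'rV[R]_d :=
  \row_(j < d) 'D_(delta_mx 0 j) f x.

Definition oracle (R : realType) (d : nat) (Resp : Type) : Type :=
  ('rV[R]_d -> R) -> 'rV[R]_d -> Resp.

Definition local_oracle (R : realType) (d : nat) (Resp : Type)
    (O : oracle R d Resp) : Prop :=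
  forall (x : 'rV[R]_d) (f g : 'rV[R]_d -> R),
    (\forall y \near x, f y = g y) -> O f x = O g x.

(* next_query packs the whole family S^(0), S^(1), ...: S^(i) is its
   restriction to the response sequences of size i. The elements of Omega are
   the realizations of xi. *)
Record algorithm (R : realType) (d : nat) (Omega Resp : Type) := Algorithm {
  next_query : Omega -> 'rV[R]_d -> seq Resp -> 'rV[R]_d ;
  final_output : Omega -> 'rV[R]_d -> seq Resp -> 'rV[R]_d
}.

(* The first n queries x_1, ..., x_n, in this order. *)
Fixpoint queries (R : realType) (d : nat) (Omega Resp : Type)
    (O : oracle R d Resp) (S : algorithm R d Omega Resp)
    (f : 'rV[R]_d -> R) (xi : Omega) (x : 'rV[R]_d) (n : nat) :
    seq 'rV[R]_d :=
  if n is m.+1 then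
    let qs := queries O S f xi x m in
    rcons qs (next_query S xi x [seq O f y | y <- qs])
  else [::].

Definition run (R : realType) (d : nat) (Omega Resp : Type)
    (O : oracle R d Resp) (S : algorithm R d Omega Resp) (T : nat)
    (f : 'rV[R]_d -> R) (x : 'rV[R]_d) (xi : Omega) : 'rV[R]_d :=
  final_output S xi x [seq O f y | y <- queries O S f xi x T].

Definition random_vector (R : realType) (d : nat) (disp : measure_display)
    (Omega : measurableType disp) (X : Omega -> 'rV[R]_d) : Prop :=
  forall j : 'I_d, measurable_fun [set: Omega] (fun xi => X xi 0 j).

(* [fine] loses nothing here: it is only applied to random vectors whose norm
   is almost surely bounded. *)
Definition expectation_vec (R : realType) (d : nat) (disp : measure_display)
    (Omega : measurableType disp) (P : probability Omega R)
    (X : Omega -> 'rV[R]_d) : 'rV[R]_d :=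
  \row_(j < d) fine ('E_P[fun xi => (X xi 0 j)%R])%E.

Definition smoother (R : realType) (d : nat) (disp : measure_display)
    (Omega : measurableType disp) (P : probability Omega R) (Resp : Type)
    (O : oracle R d Resp) (S : algorithm R d Omega Resp)
    (L eps : R) (T : nat) (M r : R) : Prop :=
  [/\ [/\ 0 < L, 0 < eps, 0 < M, 0 < r & (1 <= T)%N],
      local_oracle O &
      forall f : 'rV[R]_d -> R, elipschitz 1 f ->
      exists g : 'rV[R]_d -> R,
      [/\ forall x, differentiable g x,
          (sup_dist f g <= eps%:E)%E,
          elipschitz_vec L (gradient g) &
          forall x : 'rV[R]_d,
          [/\ forall xi y, y \in queries O S f xi x T -> enorm (y - x) <= r,
              random_vector (run O S T f x),
              enorm (expectation_vec P (run O S T f x) - gradient g x) <= eps &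
              P [set xi | enorm (run O S T f x xi) <= M] = 1%E]]].

Definition TICF (R : realType) (d : nat) (Omega Resp : Type)
    (O : oracle R d Resp) (S : algorithm R d Omega Resp) (T : nat) : Prop :=
  forall (a b : R) (x : 'rV[R]_d) (xi : Omega),
  let f : 'rV[R]_d -> R := cst a in
  let g : 'rV[R]_d -> R := cst b in
  (forall i : nat, (i < T)%N ->
     let qs := queries O S f xi x i in
     next_query S xi x [seq O f y | y <- qs] =
     next_query S xi 0 [seq O g (y - x) | y <- qs] + x) /\
  (let qs := queries O S f xi x T in
   final_output S xi x [seq O f y | y <- qs] =
   final_output S xi 0 [seq O g (y - x) | y <- qs]).

(* Main.v *)
Require Import Defs.
From HB Require Import structures.
From mathcomp Require Import all_boot all_order all_algebra.
From mathcomp Require Import all_classical all_reals all_analysis.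
From mathcomp Require Import measurable_realfun.
From mathcomp Require Import ring lra.

Set Implicit Arguments.
Unset Strict Implicit.
Unset Printing Implicit Defensive.

Import Order.TTheory GRing.Theory Num.Theory.
Import numFieldNormedType.Exports.

Local Open Scope ring_scope.

(** The idea is to hide a staircase from the smoother. Fix a unit vector [u]
and a width [w], and let [f x] be a function of [<x, u>] alone that climbs like
a staircase for [<x, u> >= 0]: it is constant on slabs of half-width [w] around
the points [4kw u], where [k] is a natural number, has slope 1 between
consecutive slabs, and hence has mean slope 1/2.

When the smoother is run at the centre [4kw u] of a slab, every query [y] with
[|<y - 4kw u, u>| < w] lies in the interior of the slab, where a local oracle
cannot tell [f] from a constant; so, as long as all queries do, the run is the
one on a constant function ([run_flat]), which by translation invariance is,
up to a shift, one and the same run for all constants and all centres. The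
queries [y] of that run at the origin are fixed by the realization of the
randomness and do not depend on [u]. By Chernoff's bound, a random direction
[u] with entries [+-1/sqrt d] satisfies [|<y, u>| >= w] for one of the [T]
queries with probability at most [2 T exp (- d w^2 / (8 r^2))]
([card_some_tail]). The choice [w = 8 r sqrt (ln ((M+1)(T+1)) / d)] makes this
so small that averaging over [u] yields one direction along which, outside a
rare event, the runs at all centres are runs on a constant
([exists_rare_direction]).

The outputs are bounded by [M], so the rare event moves the expected output at
the centres by at most 1/32 ([expectation_vec_close], [deviation_small]). The
expected output on constants has component at most [eps] along [u]
([expectation_run0_le]), because the smoothed version of a constant function
is bounded and cannot have a slope bounded away from 0. So the smoothed version
[g] of [f] has slope at most [2 eps + 1/32] along [u] at all centres. Each
point of the half-line spanned by [u] is within [2w] of a centre and the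
gradient of [g] is [L]-Lipschitz, so this slope is at most
[2 eps + 1/32 + 2 L w] everywhere on the half-line. But [g] stays within [eps]
of [f], so it has to climb with mean slope 1/2 ([slope_le_derive]):
[1/2 <= 2 eps + 1/32 + 2 L w], which is the claimed bound.

The queries are not assumed to be measurable functions of the randomness, so
no probability is ever taken of an event about queries. The event that is
measured is that the outputs differ ([deviation]); it is contained in the
event about queries, and [exists_rare_event] averages over a finite set of
directions using only a pointwise count. *)

(** * Euclidean geometry and directional derivatives *)

Definition dotv (R : realType) (d : nat) (x y : 'rV[R]_d) : R :=
  \sum_(j < d) x 0 j * y 0 j.

Section Geometry.
Context {R : realType} {d : nat}.
Implicit Types x y u : 'rV[R]_d.

Lemma dotvC x y : dotv x y = dotv y x.
Proof. by apply: eq_bigr => j _; rewrite mulrC. Qed.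

Lemma dotvDl x y u : dotv (x + y) u = dotv x u + dotv y u.
Proof. by rewrite -big_split; apply: eq_bigr => j _; rewrite mxE mulrDl. Qed.

Lemma dotvZl a x u : dotv (a *: x) u = a * dotv x u.
Proof. by rewrite mulr_sumr; apply: eq_bigr => j _; rewrite mxE mulrA. Qed.

Lemma dotvNl x u : dotv (- x) u = - dotv x u.
Proof. by rewrite -scaleN1r dotvZl mulN1r. Qed.

Lemma dotvBl x y u : dotv (x - y) u = dotv x u - dotv y u.
Proof. by rewrite dotvDl dotvNl. Qed.

Lemma enormE x : enorm x = Num.sqrt (dotv x x).
Proof. by congr Num.sqrt; apply: eq_bigr => j _; rewrite expr2. Qed.

Lemma dotvv_ge0 x : 0 <= dotv x x.
Proof. by apply: sumr_ge0 => j _; rewrite -expr2 sqr_ge0. Qed.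

Lemma enorm_ge0 x : 0 <= enorm x. Proof. exact: sqrtr_ge0. Qed.

Lemma enorm_sqr x : enorm x ^+ 2 = dotv x x.
Proof. by rewrite enormE sqr_sqrtr// dotvv_ge0. Qed.

Lemma enormZ a x : enorm (a *: x) = `|a| * enorm x.
Proof.
rewrite !enormE -sqrtr_sqr -sqrtrM ?sqr_ge0// dotvZl; congr Num.sqrt.
rewrite expr2 -mulrA; congr (_ * _); rewrite mulr_sumr.
by apply: eq_bigr => j _; rewrite mxE mulrCA.
Qed.

Lemma coord_le_enorm x j : `|x 0 j| <= enorm x.
Proof.
rewrite -sqrtr_sqr ler_wsqrtr// (bigD1 j)//= lerDl.
by apply: sumr_ge0 => k _; exact: sqr_ge0.
Qed.

Lemma dotv_le_enorm x u : enorm u = 1 -> `|dotv x u| <= enorm x.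
Proof.
move=> u1.
(* The Cauchy-Schwarz inequality, obtained from 2ab <= a^2 + b^2 with
   a = y_j and b = enorm y * u_j. *)
have amgm (y : 'rV[R]_d) : dotv y u * (enorm y *+ 2) <= enorm y ^+ 2 *+ 2.
  have -> : enorm y ^+ 2 *+ 2 = dotv y y + enorm y ^+ 2 * dotv u u.
    by rewrite -!enorm_sqr u1 expr1n mulr1 mulr2n.
  rewrite /dotv mulr_sumr mulr_suml -big_split/=; apply: ler_sum => j _.
  rewrite -subr_ge0.
  have -> : y 0 j * y 0 j + enorm y ^+ 2 * (u 0 j * u 0 j) -
            y 0 j * u 0 j * (enorm y *+ 2) = (y 0 j - enorm y * u 0 j) ^+ 2.
    by ring.
  exact: sqr_ge0.
have cs (y : 'rV[R]_d) : dotv y u <= enorm y.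
  have [y0|y0] := ltP 0 (enorm y).
    rewrite -(ler_pM2r (_ : 0 < enorm y *+ 2)) ?pmulrn_lgt0//.
    by rewrite (le_trans (amgm y))// mulrnAr expr2.
  have {}y0 : enorm y = 0 by apply/eqP; rewrite eq_le y0 enorm_ge0.
  rewrite y0 /dotv big1// => j _.
  by move: (coord_le_enorm y j); rewrite y0 normr_le0 => /eqP ->; rewrite mul0r.
rewrite ler_norml cs andbT lerNl -dotvNl.
by rewrite (le_trans (cs _))// -scaleN1r enormZ normrN normr1 mul1r.
Qed.

Lemma dotv_continuous u : continuous (fun x => dotv x u).
Proof.
apply: continuous_big => [|j _ x]; first exact: add_continuous.
by apply: (@continuousM _ _ (fun y : 'rV[R]_d => y 0 j) (fun=> u 0 j));
  [exact: coord_continuous|exact: cst_continuous].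
Qed.

Lemma gradient_derive (g : 'rV[R]_d -> R) x u : differentiable g x ->
  'D_u g x = dotv (gradient g x) u.
Proof.
move=> dg; rewrite deriveE// [in LHS](row_sum_delta u) linear_sum.
by apply: eq_bigr => j _; rewrite linearZ mxE deriveE// mulrC.
Qed.

Lemma is_derive_line (g : 'rV[R]_d -> R) u (t : R) :
  (forall x, differentiable g x) ->
  is_derive t 1 (fun s => g (s *: u)) (dotv (gradient g (t *: u)) u).
Proof.
move=> dg.
have dl : is_diff t ( *:%R^~ u : R -> 'rV[R]_d) ( *:%R^~ u).
  exact: is_diff_scalel.
have dgl : differentiable (g \o *:%R^~ u) t by apply: differentiable_comp.
apply: DeriveDef; first exact: diff_derivable.
rewrite deriveE// diff_comp//= diff_val scale1r -gradient_derive//.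
by rewrite deriveE.
Qed.

End Geometry.

(** A differentiable function that stays close to one of mean slope [sigma]
    cannot have a derivative that is everywhere smaller: the mean value theorem
    on [0, nP] gives [nP (sigma - kappa) <= 2 eps], which fails for large n. *)
Lemma slope_le_derive {R : realType} (h dh psi : R -> R)
    (eps kappa sigma P : R) :
  0 < P ->
  (forall t : R, is_derive t 1 h (dh t)) ->
  (forall t, `|h t - psi t| <= eps) ->
  (forall n : nat, psi (n%:R * P) = n%:R * P * sigma) ->
  (forall t, 0 <= t -> dh t <= kappa) ->
  sigma <= kappa.
Proof.
move=> P0 hd hpsi psiE dhle; rewrite leNgt; apply/negP => ks.
pose n := (Num.truncn (2 * eps / (P * (sigma - kappa)))).+1.
have D0 : 0 < P * (sigma - kappa) by rewrite mulr_gt0// subr_gt0.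
have nP : 2 * eps < n%:R * P * (sigma - kappa).
  by rewrite -mulrA -ltr_pdivrMr// truncnS_gt.
have nP0 : 0 < n%:R * P by rewrite mulr_gt0.
have [c cI hE] : exists2 c, c \in `]0, (n%:R * P)[ &
    h (n%:R * P) - h 0 = dh c * (n%:R * P - 0).
  apply: MVT => // ; apply: continuous_subspaceT => x.
  by apply: differentiable_continuous; apply/derivable1_diffP; case: (hd x).
have c0 : 0 <= c by move: cI; rewrite in_itv/= => /andP[/ltW].
have := hpsi 0; have := hpsi (n%:R * P).
have := psiE 0%N; rewrite !mul0r psiE => ->; rewrite subr0 in hE.
rewrite subr0 !ler_norml => /andP[h1 _] /andP[_ h2].
have : dh c * (n%:R * P) <= kappa * (n%:R * P) by rewrite ler_pM2r// dhle.
lra.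
Qed.

(** * The staircase *)

(** A V-shaped function with flat bottom of half-width [w] around [4kw]. *)
Definition tooth (R : realType) (w : R) (k : nat) (t : R) : R :=
  k%:R * w *+ 2 + Num.max 0 (`|t - k%:R * w *+ 4| - w).

(** As an infimum of 1-Lipschitz functions the staircase is 1-Lipschitz without
    any case analysis. Steps are only needed on the half-line t >= 0, and
    indexing them by naturals bounds the infimum from below. *)
Definition staircase (R : realType) (w t : R) : R :=
  inf [set tooth w k t | k in [set: nat]]%classic.

Section Staircase.
Context {R : realType} (w : R) (w0 : 0 < w).

Lemma tooth_ge0 k t : 0 <= tooth w k t.
Proof. by rewrite addr_ge0// ?le_max ?lexx// mulrn_wge0// mulr_ge0// ltW. Qed.

Lemma staircase_le_tooth k t : staircase w t <= tooth w k t.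
Proof.
apply: ge_inf; last by exists k.
by exists 0 => _ [n _ <-]; exact: tooth_ge0.
Qed.

Lemma le_staircase t a : (forall k, a <= tooth w k t) -> a <= staircase w t.
Proof.
move=> H; apply: lb_le_inf; first by exists (tooth w 0 t), 0%N.
by move=> _ [k _ <-]; exact: H.
Qed.

Lemma tooth_lipschitz k s t : tooth w k s - `|s - t| <= tooth w k t.
Proof.
rewrite /tooth -addrA lerD2l.
set c := k%:R * w *+ 4.
have := ler_normD (t - c) (s - t); have -> : t - c + (s - t) = s - c by ring.
have := normr_ge0 (s - t).
by case: (lerP 0 (`|s - c| - w)); case: (lerP 0 (`|t - c| - w)); lra.
Qed.

Lemma staircase_lipschitz s t : `|staircase w s - staircase w t| <= `|s - t|.
Proof.
have H a b : staircase w a - staircase w b <= `|a - b|.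
  rewrite lerBlDl -lerBlDr; apply: le_staircase => k.
  by rewrite (le_trans _ (tooth_lipschitz k a b))// lerB// staircase_le_tooth.
by rewrite ler_norml H andbT lerNl opprB distrC H.
Qed.

(** On the n-th step the n-th tooth is the lowest one: a later tooth has a
    higher bottom, and an earlier tooth has climbed, by t >= (4n-1)w, at least
    [4(n-k)w - 2w >= 2(n-k)w] above its own bottom. *)
Lemma staircase_flat n t : `|t - n%:R * w *+ 4| <= w ->
  staircase w t = n%:R * w *+ 2.
Proof.
move=> tn; apply/eqP; rewrite eq_le; apply/andP; split.
  apply: le_trans (staircase_le_tooth n t) _.
  by rewrite /tooth max_l ?addr0// subr_le0.
apply: le_staircase => k; rewrite /tooth.
have [nk|kn] := leqP n k.
  rewrite -[leLHS]addr0 lerD ?le_max ?lexx//.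
  by rewrite lerMn2r/= ler_pM2r// ler_nat.
have {}kn : (k%:R + 1) * w <= n%:R * w by rewrite ler_pM2r// natr1 ler_nat.
have := ler_norm (t - k%:R * w *+ 4).
move: tn; rewrite ler_norml => /andP[t1 t2].
by case: (lerP 0 (`|t - k%:R * w *+ 4| - w)); lra.
Qed.

Lemma near_flat_centre t : 0 <= t ->
  exists n : nat, `|t - n%:R * w *+ 4| <= w *+ 2.
Proof.
move=> t0; have w4 : 0 < w *+ 4 by rewrite pmulrn_lgt0.
exists (Num.truncn ((t + w *+ 2) / (w *+ 4))).
have /truncn_itv /andP[] : 0 <= (t + w *+ 2) / (w *+ 4).
  by rewrite divr_ge0 ?addr_ge0// ?mulrn_wge0// ltW.
set n := Num.truncn _.
rewrite ler_pdivlMr// ltr_pdivrMr// -[n.+1%:R]natr1 ler_norml => n1 n2.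
by apply/andP; split; lra.
Qed.

End Staircase.

(** * Random sign directions *)

Definition sign_vec (R : realType) (d : nat) (e : {ffun 'I_d -> bool}) :
    'rV[R]_d :=
  \row_j (-1) ^+ e j.

Definition sign_dir (R : realType) (d : nat) (e : {ffun 'I_d -> bool}) :
    'rV[R]_d :=
  (Num.sqrt d%:R)^-1 *: sign_vec R e.

Section Rademacher.
Context {R : realType} {d : nat}.

Lemma enorm_sign_dir e : (0 < d)%N -> enorm (sign_dir R e : 'rV[R]_d) = 1.
Proof.
move=> d0; have sd : 0 < Num.sqrt (d%:R : R) by rewrite sqrtr_gt0 ltr0n.
rewrite enormZ gtr0_norm ?invr_gt0//.
have -> : enorm (sign_vec R e : 'rV[R]_d) = Num.sqrt d%:R.
  congr Num.sqrt; under eq_bigr do rewrite mxE sqrr_sign.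
  by rewrite sumr_const card_ord.
by rewrite mulVf// gt_eqF.
Qed.

(** For |x| >= 1/2 both exponentials are at most [exp |x| <= exp (2 x^2)]. For
    |x| < 1/2 the bound [exp y <= 1 / (1 - y)] at [x] and [- x] gives
    [cosh x <= 1 / (1 - x^2) <= 1 + 2 x^2]. The optimal exponent x^2/2 is not
    worth the longer proof: only constants depend on it. *)
Lemma cosh_le (x : R) : expR x + expR (- x) <= 2 * expR (2 * x ^+ 2).
Proof.
wlog x0 : x / 0 <= x.
  move=> H; have [/H//|/ltW x0] := leP 0 x.
  by have := H (- x); rewrite opprK sqrrN oppr_ge0 addrC; exact.
have [x1|x1] := leP (2^-1) x.
  have xx : x <= 2 * x ^+ 2 by nra.
  have -> : 2 * expR (2 * x ^+ 2) = expR (2 * x ^+ 2) + expR (2 * x ^+ 2) by ring.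
  by rewrite lerD// ler_expR//; nra.
have exp_le (y : R) : `|y| < 2^-1 -> expR y <= (1 - y)^-1.
  rewrite ltr_norml => /andP[y1 y2].
  rewrite -[y in expR y]opprK expRN lef_pV2 ?posrE ?expR_gt0//; last lra.
  exact: expR_ge1Dx.
have e1 : expR x <= (1 - x)^-1 by apply: exp_le; rewrite ger0_norm.
have e2 : expR (- x) <= (1 - - x)^-1 by apply: exp_le; rewrite normrN ger0_norm.
have := expR_ge1Dx (2 * x ^+ 2).
have : (1 - x)^-1 + (1 - - x)^-1 <= 2 * (1 + 2 * x ^+ 2).
  have -> : (1 - x)^-1 + (1 - - x)^-1 = 2 / (1 - x ^+ 2).
    by field; rewrite !gt_eqF//; nra.
  have z4 : x ^+ 2 <= 4^-1 by nra.
  by rewrite ler_pdivrMr; nra.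
lra.
Qed.

(** The moment generating function: the entries are independent signs, so the
    sum over all sign vectors factors into hyperbolic cosines. *)
Lemma sum_exp_sign_vec (y : 'rV[R]_d) (l : R) :
  \sum_e expR (l * dotv y (sign_vec R e)) <=
  2 ^+ d * expR (2 * l ^+ 2 * enorm y ^+ 2).
Proof.
have -> : \sum_e expR (l * dotv y (sign_vec R e)) =
    \prod_(j < d) (expR (l * y 0 j) + expR (- (l * y 0 j))).
  transitivity (\prod_(j < d) \sum_(b : bool) expR (l * y 0 j * (-1) ^+ b)).
    rewrite bigA_distr_bigA/=; apply: eq_bigr => e _.
    rewrite /dotv mulr_sumr expR_sum; apply: eq_bigr => j _.
    by rewrite mxE mulrA.
  apply: eq_bigr => j _.
  by rewrite big_bool/= expr0 expr1 mulr1 mulrN1 addrC.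
rewrite enorm_sqr /dotv mulr_sumr expR_sum.
rewrite -[X in 2 ^+ X](card_ord d) -prodr_const -big_split/=.
apply: ler_prod => j _; rewrite addr_ge0 ?expR_ge0//=.
by rewrite (le_trans (cosh_le _))// exprMn -expr2 mulrA.
Qed.

(** Chernoff's bound: Markov's inequality for [exp (l <y, e>)], where [e] is the
    unscaled sign vector. *)
Lemma card_sign_dir_tail (y : 'rV[R]_d) (r s : R) : (0 < d)%N ->
  0 < r -> 0 <= s -> enorm y <= r ->
  #|[pred e | s <= dotv y (sign_dir R e)]|%:R <=
    2 ^+ d * expR (- (d%:R * s ^+ 2 / (8 * r ^+ 2))) :> R.
Proof.
move=> d0 r0 s0 yr.
have sd : 0 < Num.sqrt (d%:R : R) by rewrite sqrtr_gt0 ltr0n.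
have sdE : (d%:R : R) = Num.sqrt d%:R ^+ 2 by rewrite sqr_sqrtr// ler0n.
set q := Num.sqrt d%:R in sd sdE.
(* The minimizer of 2 l^2 r^2 - l s q. *)
pose l := s * q / (4 * r ^+ 2).
have l0 : 0 <= l by rewrite divr_ge0 ?mulr_ge0// ?sqr_ge0// ltW.
have markov e : (s <= dotv y (sign_dir R e))%R%:R <=
    expR (l * dotv y (sign_vec R e)) * expR (- (l * (s * q))) :> R.
  rewrite -expRD -mulrBr.
  case: (boolP (s <= _)) => [ys|_]; last by rewrite expR_ge0.
  rewrite -[leLHS]expR0 ler_expR mulr_ge0// subr_ge0.
  by move: ys; rewrite dotvC dotvZl mulrC -/q ler_pdivlMr// dotvC.
rewrite -sum1_card natr_sum big_mkcond/=.
apply: (@le_trans _ _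
  (\sum_e expR (l * dotv y (sign_vec R e)) * expR (- (l * (s * q))))).
  by apply: ler_sum => e _; rewrite (le_trans _ (markov e))// inE; case: ifP.
rewrite -mulr_suml.
apply: le_trans (ler_wpM2r (expR_ge0 _) (sum_exp_sign_vec y l)) _.
rewrite -[leLHS]mulrA -expRD ler_wpM2l ?exprn_ge0// ler_expR.
apply: (@le_trans _ _ (2 * l ^+ 2 * r ^+ 2 + - (l * (s * q)))).
  rewrite lerD2r ler_wpM2l//; first by rewrite mulr_ge0// sqr_ge0.
  by rewrite ler_sqr ?nnegrE ?enorm_ge0 ?(ltW r0).
rewrite sdE /l le_eqVlt; apply/orP; left; apply/eqP; field.
by rewrite gt_eqF.
Qed.

Lemma card_sign_dir_abs_tail (y : 'rV[R]_d) (r s : R) : (0 < d)%N ->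
  0 < r -> 0 <= s -> enorm y <= r ->
  #|[pred e | s <= `|dotv y (sign_dir R e)|]|%:R <=
    2 * (2 ^+ d * expR (- (d%:R * s ^+ 2 / (8 * r ^+ 2)))) :> R.
Proof.
move=> d0 r0 s0 yr.
have yr' : enorm (- y) <= r by rewrite -scaleN1r enormZ normrN normr1 mul1r.
have H1 := card_sign_dir_tail d0 r0 s0 yr.
have H2 := card_sign_dir_tail d0 r0 s0 yr'.
rewrite mulrDl mul1r; apply: le_trans (lerD H1 H2).
rewrite -natrD ler_nat -cardUI; apply: leq_trans (leq_addr _ _).
apply: subset_leq_card; apply/fintype.subsetP => e.
by rewrite !inE dotvNl ler_normr.
Qed.

(** The counts for the individual vectors add up, so the number of queries only
    enters as a factor. *)
Lemma card_some_tail (ys : seq 'rV[R]_d) (r s : R) : (0 < d)%N ->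
  0 < r -> 0 <= s -> (forall y, y \in ys -> enorm y <= r) ->
  #|[pred e | has (fun y => s <= `|dotv y (sign_dir R e)|) ys]|%:R <=
    2 ^+ d * (2 * (size ys)%:R * expR (- (d%:R * s ^+ 2 / (8 * r ^+ 2)))) :> R.
Proof.
move=> d0 r0 s0; elim: ys => [_|y ys IH ysr] /=.
  by rewrite mulr0 mul0r mulr0 eq_card0.
have ysr' z : z \in ys -> enorm z <= r.
  by move=> zy; rewrite ysr// in_cons zy orbT.
have H1 := card_sign_dir_abs_tail d0 r0 s0 (ysr _ (mem_head _ _)).
have := lerD H1 (IH ysr').
set E := expR _; set B : R := 2 ^+ d.
have -> : 2 * (B * E) + B * (2 * (size ys)%:R * E) =
          B * (2 * (size ys).+1%:R * E).
  by rewrite -[(size ys).+1%:R]natr1; ring.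
apply: le_trans; rewrite -natrD ler_nat -cardUI; apply: leq_trans (leq_addr _ _).
by apply: subset_leq_card; apply/fintype.subsetP => e; rewrite !inE.
Qed.

End Rademacher.

(** * Expectations of bounded random vectors *)

Section Expectation.
Local Open Scope classical_set_scope.
Context {R : realType} {d : nat} {disp : measure_display}.
Context {Omega : measurableType disp} (P : probability Omega R).
Implicit Types X Y : Omega -> 'rV[R]_d.

Lemma measurable_enorm X : random_vector X ->
  measurable_fun [set: Omega] (fun xi => enorm (X xi)).
Proof.
move=> mX.
apply: (@measurableT_comp _ _ _ _ _ _ (@Num.sqrt R)).
  exact: continuous_measurable_fun (@sqrt_continuous R).
by apply: measurable_sum => j; apply: measurable_funX; exact: mX.
Qed.

Lemma random_vector_neq_measurable X Y : random_vector X -> random_vector Y ->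
  measurable [set xi | X xi <> Y xi].
Proof.
move=> mX mY.
have -> : [set xi | X xi <> Y xi] =
    \bigcup_(j in [set: 'I_d]) [set xi | (X xi 0 j)%:E != (Y xi 0 j)%:E].
  apply/seteqP; split=> xi /=.
    move=> XY; apply: contrapT => H; apply: XY; apply/rowP => j.
    apply: contrapT => /eqP XYj; apply: H; exists j => //=.
  by move=> [j _] /= /eqP XYj XY; apply: XYj; rewrite XY.
apply: fin_bigcup_measurable => // j _; rewrite -[X in measurable X]setTI.
by apply: measurable_neqe => //; apply/measurable_EFinP; [exact: mX|exact: mY].
Qed.

Lemma ae_enorm_le X M : random_vector X ->
  P [set xi | enorm (X xi) <= M] = 1%E -> {ae P, forall xi, enorm (X xi) <= M}.
Proof.
move=> mX PX.
have mA : measurable [set xi | enorm (X xi) <= M].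
  rewrite -[X in measurable X]setTI.
  by apply: measurable_fun_le => //; exact: measurable_enorm.
exists (~` [set xi | enorm (X xi) <= M]); split => //; first exact: measurableC.
by rewrite probability_setC// PX subee.
Qed.

Lemma integrable_coord X M j : random_vector X ->
  P [set xi | enorm (X xi) <= M] = 1%E ->
  P.-integrable setT (fun xi => (X xi 0 j)%:E).
Proof.
move=> mX PX; have mXj : measurable_fun setT (fun xi => (X xi 0 j)%:E).
  by apply/measurable_EFinP; exact: mX.
apply/integrableP; split => //.
apply: (@le_lt_trans _ _ (\int[P]_xi (cst (Num.max 0 M)%:E xi))%E).
  apply: ae_ge0_le_integral => //.
  - exact: measurableT_comp.
  - by move=> xi _; rewrite lee_fin le_max lexx.
  have := ae_enorm_le mX PX; apply: filterS => xi XM _.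
  by rewrite lee_fin le_max (le_trans (coord_le_enorm _ _) XM) orbT.
by rewrite integral_cst//= probability_setT mule1 ltry.
Qed.

Lemma expectation_vec_dotv X u :
  (forall j, P.-integrable setT (fun xi => (X xi 0 j)%:E)) ->
  P.-integrable setT (fun xi => (dotv (X xi) u)%:E) /\
  (dotv (expectation_vec P X) u)%:E = (\int[P]_xi (dotv (X xi) u)%:E)%E.
Proof.
move=> iX.
have -> : (fun xi => (dotv (X xi) u)%:E) =
    (fun xi => \sum_(j < d) ((X xi 0 j)%:E * (u 0 j)%:E)%E).
  by apply/funext => xi; rewrite /dotv -sumEFin.
have iXu j : P.-integrable setT (fun xi => (X xi 0 j)%:E * (u 0 j)%:E)%E.
  exact: integrableZr.
split; first exact: integrable_sum.
rewrite integral_sum// /dotv -sumEFin; apply: eq_bigr => j _.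
rewrite integralZr// EFinM mxE unlock fineK//.
exact: integrable_fin_num.
Qed.

(** The difference of the two integrands is at most [2 M] on [D] and vanishes
    outside [D]. *)
Lemma expectation_vec_close X Y u (D : set Omega) (M p : R) :
  0 <= M -> enorm u = 1 ->
  random_vector X -> P [set xi | enorm (X xi) <= M] = 1%E ->
  random_vector Y -> P [set xi | enorm (Y xi) <= M] = 1%E ->
  measurable D -> (forall xi, ~ D xi -> X xi = Y xi) -> (P D <= p%:E)%E ->
  `|dotv (expectation_vec P X) u - dotv (expectation_vec P Y) u| <= 2 * M * p.
Proof.
move=> M0 u1 mX PX mY PY mD XY PD.
have [iX EX] := expectation_vec_dotv u (fun j => integrable_coord j mX PX).
have [iY EY] := expectation_vec_dotv u (fun j => integrable_coord j mY PY).
rewrite -lee_fin -abse_EFin EFinB EX EY -integralB_EFin//.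
have mXY : measurable_fun setT
    (fun xi => ((dotv (X xi) u)%:E - (dotv (Y xi) u)%:E)%E).
  apply: measurable_int (integrableB _ iX iY) => //.
apply: le_trans (le_abse_integral P measurableT mXY) _.
apply: (@le_trans _ _ (\int[P]_xi ((2 * M)%:E * (\1_D xi)%:E))%E).
  apply: ae_ge0_le_integral => //.
  - exact: measurableT_comp.
  - by move=> xi _; rewrite mule_ge0// lee_fin// mulr_ge0.
  - by apply: measurable_funeM; apply/measurable_EFinP; exact: measurable_indic.
  apply: filterS2 (ae_enorm_le mX PX) (ae_enorm_le mY PY) => xi XM YM _.
  rewrite -EFinB abse_EFin -EFinM lee_fin indicE.
  have [xiD|xiD] := boolP (xi \in D).
    rewrite mulr1 (le_trans (ler_normB _ _))// mulrDl mul1r.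
    by rewrite lerD// (le_trans (dotv_le_enorm _ u1)).
  by rewrite mulr0 XY ?subrr ?normr0//; move: xiD; rewrite notin_setE.
rewrite ge0_integralZl_EFin//; last 2 first.
  by apply/measurable_EFinP; exact: measurable_indic.
  by rewrite mulr_ge0.
rewrite integral_indic// setIT [leRHS]EFinM.
by rewrite lee_wpmul2l// lee_fin mulr_ge0.
Qed.

(** Integrating the pointwise count over [xi] shows that the events have average
    probability at most [p]. *)
Lemma exists_rare_event (I : finType) (D : I -> set Omega) (p : R) :
  (0 < #|I|)%N -> (forall i, measurable (D i)) ->
  (forall xi, (#|[pred i | xi \in D i]|%:R <= #|I|%:R * p)%R) ->
  exists i, (P (D i) <= p%:E)%E.
Proof.
move=> I0 mD Dp; apply: contrapT => H.
have PDp i : (p < fine (P (D i)))%R.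
  rewrite -lte_fin fineK ?fin_num_measure// ltNge; apply/negP => ?.
  by apply: H; exists i.
have : \sum_(i : I) p < \sum_(i : I) fine (P (D i)).
  apply: ltr_sum => //; have /card_gt0P[i _] := I0.
  by apply/hasP; exists i => //; exact: mem_index_enum.
apply/negP; rewrite -leNgt sumr_const -mulr_natl -lee_fin -sumEFin.
have -> : (\sum_i (fine (P (D i)))%:E = \int[P]_xi \sum_i (\1_(D i) xi)%:E)%E.
  rewrite ge0_integral_sum//.
    by apply: eq_bigr => i _; rewrite integral_indic// setIT fineK ?fin_num_measure.
  by move=> i; apply/measurable_EFinP; exact: measurable_indic.
apply: (@le_trans _ _ (\int[P]_xi (cst (#|I|%:R * p)%:E xi))%E).
  apply: ge0_le_integral => //.
  - by move=> xi _; apply: sume_ge0 => i _; rewrite lee_fin.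
  - by apply: emeasurable_sum => i; apply/measurable_EFinP; exact: measurable_indic.
  move=> xi _; rewrite sumEFin lee_fin (le_trans _ (Dp xi))//.
  rewrite -sum1_card natr_sum [leRHS]big_mkcond/=; apply: ler_sum => i _.
  by rewrite indicE inE; case: ifP => //; case: (_ \in _).
by rewrite integral_cst//= probability_setT mule1.
Qed.

End Expectation.

(** * Runs on locally constant functions *)

Section Runs.
Local Open Scope classical_set_scope.
Context {R : realType} {d : nat} {Omega Resp : Type}.
Context (O : oracle R d Resp) (S : algorithm R d Omega Resp).
Implicit Types (x : 'rV[R]_d) (f : 'rV[R]_d -> R) (xi : Omega).

(** By induction on the number of queries: responses that agree so far produce
    the same next query, and there the two functions agree locally. So it is
    enough to control the queries made on the constant function. *)
Lemma queries_local f a xi x n : local_oracle O ->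
  (forall y, y \in queries O S (cst a) xi x n -> \forall z \near y, f z = a) ->
  queries O S f xi x n = queries O S (cst a) xi x n /\
  [seq O f y | y <- queries O S (cst a) xi x n] =
  [seq O (cst a) y | y <- queries O S (cst a) xi x n].
Proof.
move=> Oloc; elim: n => [//|n IH] near_a.
have [] := IH _.
  by move=> y yn; apply: near_a; rewrite /= mem_rcons inE yn orbT.
move=> /= -> E; rewrite E; split=> //.
by apply/eq_in_map => y yq; apply: Oloc; exact: near_a.
Qed.

Lemma queries_shift T a b xi x n : TICF O S T -> (n <= T)%N ->
  queries O S (cst a) xi x n = [seq y + x | y <- queries O S (cst b) xi 0 n].
Proof.
move=> inv; elim: n => [//|n IH] nT /=.
have [/(_ n nT) /= -> _] := inv a b x xi.
rewrite map_rcons (IH (ltnW nT)) -map_comp; congr (rcons _ (next_query _ _ _ _ + _)).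
by apply: eq_map => y /=; rewrite addrK.
Qed.

Lemma run_shift T a b xi x : TICF O S T ->
  run O S T (cst a) x xi = run O S T (cst b) 0 xi.
Proof.
move=> inv; have [_ /= E] := inv a b x xi; rewrite /run E.
rewrite (queries_shift a b xi x inv (leqnn T)) -map_comp; congr final_output.
by apply: eq_map => y /=; rewrite addrK.
Qed.

(** A function that is flat near every query of the constant run, moved to [x],
    is indistinguishable from a constant. The hypothesis is about the run at
    the origin, which depends neither on [f] nor on [x]. *)
Lemma run_flat T f a b xi x : local_oracle O -> TICF O S T ->
  (forall y, y \in queries O S (cst b) xi 0 T ->
    \forall z \near y + x, f z = a) ->
  run O S T f x xi = run O S T (cst b) 0 xi.
Proof.
move=> Oloc inv near_a; rewrite -(run_shift a b xi x inv) /run.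
have [] := @queries_local f a xi x T Oloc; last by move=> -> ->.
move=> y; rewrite (queries_shift a b xi x inv (leqnn T)) => /mapP[z zq ->].
exact: near_a.
Qed.

End Runs.

(** * The staircase along a direction *)

Section Ridge.
Local Open Scope classical_set_scope.
Context {R : realType} {d : nat}.
Implicit Types (w : R) (u x y : 'rV[R]_d).

Lemma ridge_lipschitz w u : 0 < w -> enorm u = 1 ->
  elipschitz 1 (fun x => staircase w (dotv x u)).
Proof.
move=> w0 u1 x y; rewrite mul1r (le_trans (staircase_lipschitz w0 _ _))//.
by rewrite -dotvBl dotv_le_enorm.
Qed.

Lemma near_ridge_flat w u y k : 0 < w -> enorm u = 1 -> `|dotv y u| < w ->
  \forall z \near y + (k%:R * w *+ 4) *: u,
    staircase w (dotv z u) = k%:R * w *+ 2.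
Proof.
move=> w0 u1 yw; have e0 : 0 < w - `|dotv y u| by rewrite subr_gt0.
have /cvgrPdist_lt /(_ _ e0) := @dotv_continuous R d u (y + (k%:R * w *+ 4) *: u).
apply: filterS => z; rewrite dotvDl dotvZl -enorm_sqr u1 expr1n mulr1 => zy.
apply: staircase_flat => //.
have := ler_normB (dotv y u) (dotv y u + k%:R * w *+ 4 - dotv z u).
have -> : dotv y u - (dotv y u + k%:R * w *+ 4 - dotv z u) =
          dotv z u - k%:R * w *+ 4.
  by ring.
by move=> /le_trans; apply; lra.
Qed.

Lemma sup_dist_le (f g : 'rV[R]_d -> R) eps : (sup_dist f g <= eps%:E)%E ->
  forall x, `|f x - g x| <= eps.
Proof.
move=> fg x; rewrite -lee_fin (le_trans _ fg)//.
by apply: ereal_sup_ubound; exists x.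
Qed.

End Ridge.

(** * The lower bound *)

Section Smoother.
Context {R : realType} {d : nat} {disp : measure_display}.
Context {Omega : measurableType disp} (P : probability Omega R).
Context {Resp : Type} (O : oracle R d Resp) (S : algorithm R d Omega Resp).
Context (L eps : R) (T : nat) (M r : R).
Context (smoothS : smoother P O S L eps T M r) (ticfS : TICF O S T).
Implicit Types u : 'rV[R]_d.

Let run0 := run O S T (cst 0) 0.

Lemma cst0_lipschitz : elipschitz 1 (cst 0 : 'rV[R]_d -> R).
Proof. by move=> x y; rewrite subrr normr0 mul1r enorm_ge0. Qed.

(** The smoothed version [g] of the zero function has, along [u], slope at least
    [<expectation_vec P run0, u> - eps] at every point, since the expected
    output is the same everywhere; but [g] is bounded by [eps]. *)
Lemma expectation_run0_le u : enorm u = 1 ->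
  dotv (expectation_vec P run0) u <= eps.
Proof.
move=> u1; have [_ _ /(_ _ cst0_lipschitz) [g [dg fg _ Hg]]] := smoothS.
rewrite -subr_ge0.
apply: (@slope_le_derive _ (fun t => - g (t *: u))
  (fun t => - dotv (gradient g (t *: u)) u) (cst 0) eps _ 0 1) => //.
- by move=> t; apply: is_deriveN; exact: is_derive_line.
- by move=> t; have := sup_dist_le fg (t *: u); rewrite /= sub0r subr0.
- by move=> n; rewrite mulr0.
move=> t _; have [_ _ + _] := Hg (t *: u).
have -> : run O S T (cst 0) (t *: u) = run0.
  by apply/funext => xi; exact: run_shift.
move=> /(le_trans (dotv_le_enorm _ u1)); rewrite dotvBl ler_norml => /andP[_].
lra.
Qed.

Let budget : R := (M + 1) * (T%:R + 1).

(** With this width a direction fails with probability at most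
    [2 T / budget ^ 8]; the power 8 leaves room for the factors [T] and [M] and
    makes the total error at most 1/32. *)
Let w : R := 8 * r * Num.sqrt (ln budget / d%:R).

Let ridge e (x : 'rV[R]_d) := staircase w (dotv x (sign_dir R e)).

Let centre e k : 'rV[R]_d := (k%:R * w *+ 4) *: sign_dir R e.

(** The realizations that notice the staircase at some centre. It is stated on
    outputs, which are measurable, not on queries, which need not be. All
    centres are treated at once so that one direction serves all of them. *)
Let deviation e :=
  (\bigcup_k [set xi | run O S T (ridge e) (centre e k) xi <> run0 xi])%classic.

Lemma budget_ge2 : 2 <= budget.
Proof.
have [[_ _ M0 _ T1] _ _] := smoothS.
have : (1 : R) <= T%:R by rewrite ler1n.
rewrite /budget; nra.
Qed.

Lemma ln_budget_gt0 : 0 < ln budget.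
Proof. by apply: ln_gt0; apply: lt_le_trans budget_ge2; rewrite ltr1n. Qed.

Context (d0 : (0 < d)%N).

Lemma w_gt0 : 0 < w.
Proof.
have [[_ _ _ r0 _] _ _] := smoothS.
by rewrite !mulr_gt0// sqrtr_gt0 divr_gt0 ?ln_budget_gt0// ltr0n.
Qed.

Lemma tail_exponent : expR (- (d%:R * w ^+ 2 / (8 * r ^+ 2))) = budget ^- 8.
Proof.
have [[_ _ _ r0 _] _ _] := smoothS.
have A0 : budget \is Num.pos by rewrite posrE (lt_le_trans _ budget_ge2).
have d0' : (d%:R : R) != 0 by rewrite pnatr_eq0 -lt0n.
have -> : - (d%:R * w ^+ 2 / (8 * r ^+ 2)) = - (ln budget *+ 8).
  rewrite /w exprMn sqr_sqrtr; last by rewrite divr_ge0// ltW// ln_budget_gt0.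
  by field; rewrite d0' gt_eqF.
by rewrite expRN -lnXn -?posrE// lnK// posrE exprn_gt0.
Qed.

Lemma size_queries f xi x n : size (queries O S f xi x n) = n.
Proof. by elim: n => //= n IH; rewrite size_rcons IH. Qed.

Lemma random_vector_run f x : elipschitz 1 f -> random_vector (run O S T f x).
Proof. by case: smoothS => _ _ /[apply] -[g [_ _ _ /(_ x)[]]]. Qed.

Lemma run_bounded f x : elipschitz 1 f ->
  P [set xi | enorm (run O S T f x xi) <= M]%classic = 1%E.
Proof. by case: smoothS => _ _ /[apply] -[g [_ _ _ /(_ x)[]]]. Qed.

Lemma deviation_measurable e : measurable (deviation e).
Proof.
apply: bigcup_measurable => k _; apply: random_vector_neq_measurable.
  by apply: random_vector_run; apply: ridge_lipschitz w_gt0 (enorm_sign_dir _ d0).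
exact: random_vector_run cst0_lipschitz.
Qed.

Lemma deviation_tail e xi : deviation e xi ->
  has (fun y => w <= `|dotv y (sign_dir R e)|) (queries O S (cst 0) xi 0 T).
Proof.
have [_ Oloc _] := smoothS.
move=> [k _ /= neq]; apply: contra_notT neq => /hasPn small.
apply: (@run_flat _ _ _ _ _ _ _ _ (k%:R * w *+ 2)) => // y /small.
by rewrite -ltNge; apply: near_ridge_flat; [exact: w_gt0|exact: enorm_sign_dir].
Qed.

(** For each realization only a small fraction of the directions can have been
    noticed, hence some direction is noticed with small probability. *)
Lemma exists_rare_direction :
  exists e, (P (deviation e) <= (2 * T%:R * budget ^- 8)%:E)%E.
Proof.
have cardE : #|{ffun 'I_d -> bool}| = (2 ^ d)%N.
  by rewrite card_ffun card_bool card_ord.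
apply: exists_rare_event.
- by rewrite cardE expn_gt0.
- exact: deviation_measurable.
move=> xi; have [[_ _ _ r0 _] _ /(_ _ cst0_lipschitz) [g [_ _ _ Hg]]] := smoothS.
have [qr _ _ _] := Hg 0.
rewrite cardE natrX -tail_exponent.
rewrite -[X in _ * X%:R * expR _](size_queries (cst 0) xi 0).
apply: le_trans (card_some_tail d0 r0 (ltW w_gt0) _); last first.
  by move=> y /qr; rewrite subr0.
rewrite ler_nat; apply: subset_leq_card; apply/fintype.subsetP => e.
by rewrite !inE => /deviation_tail.
Qed.

(** [M T <= budget] leaves [4 / budget ^ 7 <= 4 / 2 ^ 7]. *)
Lemma deviation_small : 2 * M * (2 * T%:R * budget ^- 8) <= 32^-1.
Proof.
have [[_ _ M0 _ _] _ _] := smoothS.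
have A2 := budget_ge2; have A0 : 0 < budget by rewrite (lt_le_trans _ A2).
have MT : M * T%:R <= budget by rewrite /budget; have := ler0n R T; nra.
have -> : 2 * M * (2 * T%:R * budget ^- 8) = 4 * (M * T%:R) / budget ^+ 8.
  by field; rewrite gt_eqF.
rewrite ler_pdivrMr ?exprn_gt0//.
have A7 : 2 ^+ 7 <= budget ^+ 7 by rewrite lerXn2r ?nnegrE ?(ltW A0).
rewrite exprS.
have : budget * 2 ^+ 7 <= budget * budget ^+ 7 by rewrite ler_pM2l.
lra.
Qed.

(** The smoothed staircase climbs with mean slope 1/2, while its slope along [u]
    is at most [2 eps + 1/32] at the centres and changes by at most [2 L w]
    between a point and the nearest centre. *)
Lemma slope_bound : 2^-1 <= 2 * eps + 32^-1 + 2 * L * w.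
Proof.
have w0 := w_gt0.
have [e Pe] := exists_rare_direction.
set u : 'rV[R]_d := sign_dir R e.
have u1 : enorm u = 1 by exact: enorm_sign_dir.
have ridgeL : elipschitz 1 (ridge e) by exact: ridge_lipschitz.
have [[L0 _ M0 _ _] _ /(_ _ ridgeL) [g [dg fg gL Hg]]] := smoothS.
have at_centre k : dotv (gradient g (centre e k)) u <= 2 * eps + 32^-1.
  have [_ mX EX PX] := Hg (centre e k).
  have := le_trans (dotv_le_enorm _ u1) EX.
  have := @expectation_vec_close _ _ _ _ P _ run0 u _ M _ (ltW M0) u1 mX PX
    (random_vector_run 0 cst0_lipschitz) (run_bounded 0 cst0_lipschitz)
    (deviation_measurable e) _ Pe.
  move=> /(_ _)/wrap[xi nD|].
    by apply: contrapT => neq; apply: nD; exists k.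
  have := deviation_small; have := expectation_run0_le u1.
  rewrite dotvBl !ler_norml => ? ? /andP[_ ?] /andP[? _]; lra.
apply: (@slope_le_derive _ (fun t => g (t *: u))
  (fun t => dotv (gradient g (t *: u)) u) (staircase w) eps _ _ (w *+ 4)).
- by rewrite pmulrn_lgt0.
- by move=> t; exact: is_derive_line.
- move=> t; have := sup_dist_le fg (t *: u).
  by rewrite /ridge dotvZl -enorm_sqr u1 expr1n mulr1 distrC.
- move=> n; rewrite (@staircase_flat _ _ _ n) -?mulrnAr ?subrr ?normr0 ?ltW//.
  by rewrite mulrnAr; lra.
move=> t t0; have [k tk] := near_flat_centre w0 t0.
have := le_trans (dotv_le_enorm _ u1) (gL (t *: u) (centre e k)).
rewrite dotvBl -scalerBl enormZ u1 mulr1 => /ler_normlW.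
have := at_centre k; have := ler_wpM2l (ltW L0) tk; lra.
Qed.

Lemma smoother_lower_bound :
  8^-1 * (Num.sqrt d%:R / r) * (15 / 64 - eps) <= L * Num.sqrt (ln budget).
Proof.
have [[_ _ _ r0 _] _ _] := smoothS.
have sd : 0 < Num.sqrt (d%:R : R) by rewrite sqrtr_gt0 ltr0n.
have Lw : 15 / 64 - eps <= L * w by have := slope_bound; lra.
apply: le_trans (ler_wpM2l _ Lw) _.
  by rewrite mulr_ge0// divr_ge0// ltW.
rewrite /w sqrtrM; last exact: ltW ln_budget_gt0.
rewrite sqrtrV ?ler0n// le_eqVlt; apply/orP; left.
by apply/eqP; field; rewrite !gt_eqF.
Qed.

End Smoother.

Theorem theorem2 (R : realType) :
  exists c1 c2 : R, [/\ 0 < c1, 0 < c2 &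
    forall (d : nat) (disp : measure_display) (Omega : measurableType disp)
      (P : probability Omega R) (Resp : Type) (O : oracle R d Resp)
      (S : algorithm R d Omega Resp) (L eps : R) (T : nat) (M r : R),
      smoother P O S L eps T M r ->
      TICF O S T ->
      L * Num.sqrt (ln ((M + 1) * (T%:R + 1))) >=
        c1 * (Num.sqrt d%:R / r) * (c2 - eps)].
Proof.
exists 8^-1, (15 / 64); split; [lra|lra|].
move=> d disp Omega P Resp O S L eps T M r smoothS ticfS.
have [d0|d0] := posnP d; last exact: smoother_lower_bound smoothS ticfS d0.
have [[L0 _ _ _ _] _ _] := smoothS.
by rewrite d0 sqrtr0 mul0r mulr0 mul0r mulr_ge0// ltW.
Qed.
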